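(* Let $A=\{0,1\}$, let $v(\omega,1)\ge v(\omega,0)$ for all $\omega\in\Omega$, let $\mathcal P_0,\mathcal P_1$ be closed, and assume that $\mathcal P_1^c=\{\mu\in\Delta(\Omega):\hat\rho(\mu)<0\}$ is convex. Then $\Omega\cup K_{01}$ is a canonical set of signals: for every prior $\mu^*\in\Delta(\Omega)$ there is an optimal signaling scheme all of whose induced posterior beliefs lie in $\Omega\cup K_{01}$, i.e. each signal either fully reveals the state or induces a belief $\chi(\omega_0,\omega_1)$ supported on two states $\omega_0\in L_0$ and $\omega_1\in K_1$.
   Context: $\Omega$ is a finite nonempty set of states, $\Delta(\Omega)\subset\mathbb R^\Omega$ the simplex of probability vectors. The receiver's utility is a function $\rho:\Delta(\Omega)\times\{0,1\}\to\mathbb R$, the sender's utility is $v:\Omega\times\{0,1\}\to\mathbb R$, and $\hat\rho(\mu)=\rho(\mu,1)-\rho(\mu,0)$. Put $\mathcal P_1=\{\mu\in\Delta(\Omega):\hat\rho(\mu)\ge0\}$ and $\mathcal P_0=\{\mu\in\Delta(\Omega):\hat\rho(\mu)\le0\}$; complements are taken in $\Delta(\Omega)$. A state $\omega$ is identified with the point mass $e_\omega\in\Delta(\Omega)$, so $\Omega\subset\Delta(\Omega)$. Define $K_1=\mathcal P_1\cap\Omega$, $K_0=\mathcal P_0\cap\Omega$, $L_0=K_0\cap K_1^c$. For $\omega_0\in L_0$, $\omega_1\in K_1$ let $\gamma(\omega_0,\omega_1)=\sup\{\gamma\in[0,1]:\gamma\omega_0+(1-\gamma)\omega_1\in\mathcal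 P_1\}$, $\chi(\omega_0,\omega_1)=\gamma(\omega_0,\omega_1)\,\omega_0+(1-\gamma(\omega_0,\omega_1))\,\omega_1$, and $K_{01}=\{\chi(\omega_0,\omega_1):\omega_0\in L_0,\ \omega_1\in K_1\}$. A signaling scheme $(S,\pi)$ for prior $\mu^*$ consists of a (standard Borel) signal space $S$ and a joint distribution $\pi$ of $(\bar\omega,\bar s)$ on $\Omega\times S$ with $\Omega$-marginal $\mu^*$; the posterior induced by signal $s$ is the conditional distribution $\mu_s$ of $\bar\omega$ given $\bar s=s$. A (measurable) receiver strategy $a:S\to\{0,1\}$ is optimal if $a(s)\in\arg\max_{a}\rho(\mu_s,a)$ for all $s$. The sender maximizes $\mathbf E_\pi[v(\bar\omega,a(\bar s))]$ over signaling schemes and optimal receiver strategies (ties broken in the sender's favour); a scheme is optimal if it attains this maximum. *)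

(* Defs.v *)
From HB Require Import structures.
From mathcomp Require Import all_boot all_order all_algebra.
From mathcomp Require Import all_classical all_reals all_analysis.
Import Order.TTheory GRing.Theory Num.Theory.
Import numFieldNormedType.Exports.

Set Implicit Arguments.
Unset Strict Implicit.
Unset Printing Implicit Defensive.

Local Open Scope classical_set_scope.
Local Open Scope ring_scope.

(* A finite type with the power-set sigma-algebra.  Measurable types are pointed
   in the library, whence the element x0, which plays no other role. *)
Definition discrete_space (T : finType) (x0 : T) : Type := T.

Section DiscreteSpace.
Context (T : finType) (x0 : T).
HB.instance Definition _ := Finite.on (discrete_space x0).
HB.instance Definition _ := isPointed.Build (discrete_space x0) x0.
HB.instance Definition _ := @isMeasurable.Build default_measure_display
  (discrete_space x0) (@discrete_measurable T) (@discrete_measurable0 T)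
  (@discrete_measurableC T) (@discrete_measurableU T).
End DiscreteSpace.

(* The sigma-algebra is the Borel one of a Polish topology.  The topology is
   carried by an auxiliary space X in bijection with S. *)
Definition standard_borel (R : realType) d (S : measurableType d) : Prop :=
  exists (X : completePseudoMetricType R) (f : S -> X),
    [/\ hausdorff_space X,
        exists2 D : set X, countable D & dense D,
        bijective f &
        forall A : set S,
          measurable A <-> exists2 B : set X, <<s open >> B & A = f @^-1` B].

Section Beliefs.
Context {R : realType} {Omega : finType}.

Definition simplex : set (Omega -> R) :=
  [set mu | (forall w, 0 <= mu w) /\ \sum_w mu w = 1].

Definition point_mass (w : Omega) : Omega -> R := fun w' => (w' == w)%:R.

(* The actions 0 and 1 are false and true.  The receiver's utility is a total
   function on R^Omega, but is only ever evaluated on the simplex. *)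
Variable rho : (Omega -> R) -> bool -> R.

Definition rho_hat (mu : Omega -> R) : R := rho mu true - rho mu false.

Definition P1 : set (Omega -> R) := simplex `&` [set mu | 0 <= rho_hat mu].
Definition P0 : set (Omega -> R) := simplex `&` [set mu | rho_hat mu <= 0].

Definition K1 : set Omega := point_mass @^-1` P1.
Definition K0 : set Omega := point_mass @^-1` P0.
Definition L0 : set Omega := K0 `&` ~` K1.

Definition mix (g : R) (w0 w1 : Omega) : Omega -> R :=
  g *: point_mass w0 + (1 - g) *: point_mass w1.

Definition gamma (w0 w1 : Omega) : R :=
  sup [set g | 0 <= g <= 1 /\ P1 (mix g w0 w1)].

Definition chi (w0 w1 : Omega) : Omega -> R := mix (gamma w0 w1) w0 w1.

Definition K01 : set (Omega -> R) :=
  [set mu | exists w0 w1, [/\ L0 w0, K1 w1 & mu = chi w0 w1]].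

End Beliefs.

Section Persuasion.
Context {R : realType} {Omega : finType} (omega0 : Omega).
Variables (rho : (Omega -> R) -> bool -> R) (v : Omega -> bool -> R).

Local Notation states := (discrete_space omega0).

Section Scheme.
Context d (S : measurableType d) (pi : probability (states * S)%type R).

Definition has_prior (mu : Omega -> R) : Prop :=
  forall w : states, pi ([set w] `*` setT) = (mu w)%:E.

(* m is a regular conditional distribution of the state given the signal.  It
   is determined only up to a null set of signals; a scheme is taken together
   with one version of it, so that the belief after each signal is defined. *)
Definition is_posterior (m : S -> Omega -> R) : Prop :=
  [/\ forall s, simplex (m s),
      forall w, measurable_fun setT (fun s => m s w) &
      forall (w : states) (B : set S), measurable B ->
        pi ([set w] `*` B) = (\int[pi]_(x in setT `*` B) (m x.2 w)%:E)%E].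

Definition is_scheme (mu : Omega -> R) (m : S -> Omega -> R) : Prop :=
  [/\ standard_borel R S, has_prior mu & is_posterior m].

Definition receiver_optimal (m : S -> Omega -> R) (a : S -> bool) : Prop :=
  measurable_fun setT a /\ forall s b, rho (m s) b <= rho (m s) (a s).

Definition sender_payoff (a : S -> bool) : \bar R :=
  ('E_pi[fun x => v x.1 (a x.2)])%E.

End Scheme.

Definition optimal_scheme (mu : Omega -> R) d (S : measurableType d)
    (pi : probability (states * S)%type R) (m : S -> Omega -> R) : Prop :=
  is_scheme pi mu m /\
  exists2 a : S -> bool, receiver_optimal m a &
    forall d' (S' : measurableType d') (pi' : probability (states * S')%type R)
        (m' : S' -> Omega -> R) (a' : S' -> bool),
      is_scheme pi' mu m' -> receiver_optimal m' a' ->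
      (sender_payoff pi' a' <= sender_payoff pi a)%E.

Definition canonical_signals (C : set (Omega -> R)) : Prop :=
  forall mu, simplex mu ->
  exists d (S : measurableType d) (pi : probability (states * S)%type R)
      (m : S -> Omega -> R),
    optimal_scheme mu pi m /\ forall s, C (m s).

End Persuasion.

(* Main.v *)
Require Import Defs.
From HB Require Import structures.
From mathcomp Require Import all_boot all_order all_algebra.
From mathcomp Require Import all_classical all_reals all_analysis.
From mathcomp Require Import measurable_realfun ring lra.
Import Order.TTheory GRing.Theory Num.Theory.
Import numFieldNormedType.Exports.
Local Open Scope classical_set_scope.
Local Open Scope ring_scope.

(* Only the mass q w that a scheme sends to action 1 in state w matters for the
   sender.  If a linear form is nonnegative on every chi w0 w1, then it is
   nonnegative on P1: otherwise a belief of P1 would be a convex combination of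
   vertices and of edge points at which the form is negative, all of which lie
   in the convex complement of P1.  By Farkas' lemma q is thus a nonnegative
   combination of the chi w0 w1.  Sending these beliefs and revealing the state
   with the remaining mass costs the sender nothing, since v is monotone in the
   action.  What remains is a linear program over finitely many signals, whose
   maximum is attained, again by Farkas' lemma. *)

(** * Farkas' lemma and attainment in linear programs *)

(* Bartl's induction on the number of generators: a point x refuting the
   hypothesis for all generators but one allows to project along x, after
   which that generator becomes superfluous. *)
Lemma farkas_ord (R : realFieldType) (J : finType) (m : nat)
    (a : 'I_m -> J -> R) (q : J -> R) :
  (forall x : J -> R, (forall i, 0 <= \sum_j a i j * x j) ->
    0 <= \sum_j q j * x j) ->
  exists2 c : 'I_m -> R, forall i, 0 <= c i &
    forall j, q j = \sum_i c i * a i j.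
Proof.
elim: m a q => [|m IH] a q hq.
  exists (fun=> 0) => [//|j]; rewrite big_ord0.
  (* Without generators every [x] is admissible; testing [e] times a unit vector, with [e = 1] and
     [e = -1], gives [q j = 0]. *)
  have hj (e : R) : 0 <= q j * e.
    have /hq : forall i, 0 <= \sum_k a i k * (if k == j then e else 0).
      by case.
    rewrite (bigD1 j)//= eqxx big1 ?addr0// => k /negPf ->.
    by rewrite mulr0.
  apply/eqP; rewrite eq_le; apply/andP; split.
    by move: (hj (-1)); rewrite mulrN1 oppr_ge0.
  by move: (hj 1); rewrite mulr1.
pose h (k : 'I_m) := lift ord0 k.
have [hm|/existsNP[x /not_implyP[ax /negP qx]]] := pselect (forall x : J -> R,
    (forall i, 0 <= \sum_j a (h i) j * x j) -> 0 <= \sum_j q j * x j).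
  have [c c0 qc] := IH _ _ hm.
  exists (fun i => oapp c 0 (unlift ord0 i)) => [i|j].
    by case: unlift => //= k; exact: c0.
  rewrite qc big_ord_recl unlift_none /= mul0r add0r.
  by apply: eq_bigr => i _; rewrite liftK.
rewrite -ltNge in qx.
set b := \sum_j a ord0 j * x j.
have b0 : b < 0.
  rewrite ltNge; apply/negP => b0; move: qx; rewrite ltNge => /negP; apply.
  by apply: hq => i; case: (unliftP ord0 i) => [k|] ->; [exact: ax|exact: b0].
have bn0 : b != 0 by rewrite lt_eqF.
(* The form [f - t f * a ord0] vanishes at [x]. By [sumE], evaluating it at [y] amounts to
   evaluating [f] at [y] shifted along [x] until [a ord0] vanishes. *)
pose t (f : J -> R) := (\sum_j f j * x j) / b.
have sumE (f y : J -> R) :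
    \sum_j (f j - t f * a ord0 j) * y j =
    \sum_j f j * (y j - (\sum_k a ord0 k * y k) / b * x j).
  under eq_bigr do rewrite mulrBl.
  under [RHS]eq_bigr do rewrite mulrBr.
  rewrite !sumrB; congr (_ - _).
  under eq_bigr do rewrite -mulrA.
  under [RHS]eq_bigr do rewrite mulrCA.
  by rewrite -!mulr_sumr /t; field.
have [c c0 qc] : exists2 c : 'I_m -> R, forall i, 0 <= c i &
    forall j, q j - t q * a ord0 j =
      \sum_i c i * (a (h i) j - t (a (h i)) * a ord0 j).
  apply: IH => y ay; rewrite sumE; apply: hq => i.
  case: (unliftP ord0 i) => [k|] ->; first by rewrite -sumE; exact: ay.
  under eq_bigr do rewrite mulrBr mulrCA.
  by rewrite sumrB -mulr_sumr -/b divfK// subrr.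
(* The coefficient at [ord0] collects all multiples of [a ord0]. It is nonnegative because [b < 0]
   makes [t q] positive and each [t (a (h i))] nonpositive. *)
exists (fun i => oapp c (t q - \sum_i c i * t (a (h i))) (unlift ord0 i)).
  move=> i; case: unlift => [k|] /=; first exact: c0.
  rewrite subr_ge0 (@le_trans _ _ 0)//.
    apply: sumr_le0 => k _; apply: mulr_ge0_le0; first exact: c0.
    by rewrite /t mulr_ge0_le0// invr_le0 ltW.
  by rewrite /t ltW// nmulr_rgt0// invr_lt0.
move=> j; rewrite big_ord_recl unlift_none /=.
under [X in _ = _ + X]eq_bigr do rewrite liftK /=.
have : q j - t q * a ord0 j = \sum_i c i * a (h i) j -
    (\sum_i c i * t (a (h i))) * a ord0 j.
  by rewrite qc mulr_suml -sumrB; apply: eq_bigr => i _; rewrite mulrBr mulrA.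
by move/eqP; rewrite subr_eq => /eqP ->; rewrite mulrBl; ring.
Qed.

Lemma farkas (R : realFieldType) (I J : finType) (a : I -> J -> R)
    (q : J -> R) :
  (forall x : J -> R, (forall i, 0 <= \sum_j a i j * x j) ->
    0 <= \sum_j q j * x j) ->
  exists2 c : I -> R, forall i, 0 <= c i & forall j, q j = \sum_i c i * a i j.
Proof.
move=> hq.
have [x ax|c c0 qc] := @farkas_ord _ _ #|I| (fun k => a (enum_val k)) q.
  by apply: hq => i; rewrite -(enum_rankK i); exact: ax.
exists (fun i => c (enum_rank i)) => [i|j]; first exact: c0.
rewrite qc (reindex_onto enum_rank enum_val) => [|i _]; last by rewrite enum_valK.
apply: eq_big => [i|i _]; by rewrite enum_rankK// eqxx.
Qed.

(* If the supremum V were not attained, Farkas' lemma would provide a linear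
   form showing that the values of feasible points stay away from V. *)
Lemma lp_max (R : realType) (I J : finType) (a : I -> J -> R) (q : J -> R)
    (p : I -> R) (B : R) (c0 : I -> R)
    (feas := fun c : I -> R =>
      (forall i, 0 <= c i) /\ forall j, q j = \sum_i c i * a i j) :
  feas c0 -> (forall c, feas c -> \sum_i c i * p i <= B) ->
  exists2 c, feas c &
    forall c', feas c' -> \sum_i c' i * p i <= \sum_i c i * p i.
Proof.
move=> fc0 hB.
pose E := [set r | exists2 c, feas c & r = \sum_i c i * p i].
have hE : has_sup E.
  split; first by exists (\sum_i c0 i * p i), c0.
  by exists B => _ [c fc ->]; exact: hB.
(* The extra coordinate [None] records the objective: a representation of [q'] is a feasible point
   of value [sup E]. *)
pose a' i (o : option J) := if o is Some j then a i j else p i.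
pose q' (o : option J) := if o is Some j then q j else sup E.
have sumO (f : option J -> R) : \sum_o f o = f None + \sum_j f (Some j).
  rewrite (bigD1 None)//=; congr (_ + _).
  rewrite (reindex_omap Some id)/=; last by case.
  by apply: eq_bigl => j; rewrite eqxx.
have [x ax|c c_ge0 qc] := @farkas R I (option J) a' q'.
  rewrite sumO /=; set t := x None; set y := fun j => x (Some j).
  have {}ax i : 0 <= p i * t + \sum_j a i j * y j.
    by have := ax i; rewrite sumO.
  have feas_ge c : feas c -> 0 <= (\sum_i c i * p i) * t + \sum_j q j * y j.
    move=> [c_ge0 qc]; under [X in _ + X]eq_bigr do rewrite qc mulr_suml.
    rewrite exchange_big /= mulr_suml -big_split /=; apply: sumr_ge0 => i _.
    rewrite (_ : _ + _ = c i * (p i * t + \sum_j a i j * y j)).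
      by rewrite mulr_ge0.
    rewrite mulrDr mulrA mulr_sumr; congr (_ + _).
    by apply: eq_bigr => j _; rewrite mulrA.
  have [t0|t0] := leP 0 t.
    apply: le_trans (feas_ge _ fc0) _; rewrite lerD2r ler_wpM2r//.
    by apply: ub_le_sup; [exact: hE.2|exists c0].
  rewrite leNgt; apply/negP => neg.
  (* Since [t < 0], every feasible value is at most [- s / t], which [neg] places below [sup E] by a
     positive gap. *)
  set s := \sum_j q j * y j in feas_ge neg.
  have e0 : 0 < (sup E * t + s) / t by rewrite nmulr_lgt0// invr_lt0.
  have [_ [c fc ->]] := sup_adherent e0 hE.
  rewrite (_ : _ - _ = - s / t); last by field; rewrite lt_eqF.
  rewrite ltr_ndivrMr// -subr_lt0 opprK => /lt_geF.
  by rewrite (feas_ge _ fc).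
exists c; first by split=> // j; exact: (qc (Some j)).
move=> c' fc'; rewrite -(qc None) /=.
by apply: ub_le_sup; [exact: hE.2|exists c'].
Qed.

(** * Point masses and beliefs on two states *)

Section PointMass.
Context {R : realType} {Omega : finType}.
Implicit Types (w : Omega) (l : Omega -> R) (g : R).

Lemma sum_point_mass w l : \sum_w' point_mass w w' * l w' = l w.
Proof.
rewrite (bigD1 w)//= /point_mass eqxx mul1r big1 ?addr0// => i /negPf ->.
by rewrite mul0r.
Qed.

Lemma mixE g w0 w1 w :
  mix g w0 w1 w = g * point_mass w0 w + (1 - g) * point_mass w1 w.
Proof. by []. Qed.

Lemma sum_mix g w0 w1 l :
  \sum_w mix g w0 w1 w * l w = g * l w0 + (1 - g) * l w1.
Proof.
under eq_bigr do rewrite mixE mulrDl -!mulrA.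
by rewrite big_split/= -!mulr_sumr !sum_point_mass.
Qed.

Lemma mixxx g w : mix g w w = point_mass w :> (Omega -> R).
Proof. by rewrite /mix -scalerDl addrC subrK scale1r. Qed.

Lemma mix0 w0 w1 : mix 0 w0 w1 = point_mass w1 :> (Omega -> R).
Proof. by rewrite /mix scale0r add0r subr0 scale1r. Qed.

Lemma mix1 w0 w1 : mix 1 w0 w1 = point_mass w0 :> (Omega -> R).
Proof. by rewrite /mix subrr scale0r addr0 scale1r. Qed.

Lemma simplex_mix g w0 w1 : 0 <= g <= 1 -> simplex (mix g w0 w1).
Proof.
move=> /andP[g0 g1]; split=> [w|].
  by rewrite mixE addr_ge0// mulr_ge0// ?subr_ge0// ler0n.
have := sum_mix g w0 w1 (fun=> 1); under eq_bigr do rewrite mulr1.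
by move=> ->; ring.
Qed.

Lemma simplex_point_mass w : simplex (point_mass w : Omega -> R).
Proof. by rewrite -(mix0 w); apply: simplex_mix; rewrite lexx ler01. Qed.

Lemma simplex_le1 (mu : Omega -> R) w : simplex mu -> mu w <= 1.
Proof.
by move=> [mu0 <-]; rewrite (bigD1 w)//= lerDl sumr_ge0.
Qed.

(** The pointwise topology is a supremum of topologies induced by evaluations, so it suffices to
    check each coordinate. This pulls closedness of [P1] back to the edges of the simplex. *)
Lemma continuous_mix w0 w1 :
  continuous (fun g : R => mix g w0 w1 : {ptws Omega -> R}).
Proof.
move=> g; apply/cvg_sup => w U [V [[W oW <-] Wg] WU].
apply: (filterS WU); rewrite nbhs_simpl /=.
have : (fun g => mix g w0 w1 w) @ g --> mix g w0 w1 w.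
  rewrite mixE; apply: cvgD; apply: cvgMl => //.
  by apply: cvgB => //; exact: cvg_cst.
by apply; exact: open_nbhs_nbhs.
Qed.

End PointMass.

(** * Linear forms nonnegative on the beliefs [chi] *)

(** Two rays combine with the convex weights [t / (t + u)] and [u / (t + u)]. Zero is adjoined so
    that empty sums and vanishing terms stay in the cone. *)
Lemma convex_cone_add (R : realType) (E : lmodType R) (C : set E)
    (cone := fun x : E => x = 0 \/ exists t y, [/\ 0 < t, C y & x = t *: y]) :
  convex_set (C : set (convex_lmodType E)) ->
  forall x y, cone x -> cone y -> cone (x + y).
Proof.
move=> cC _ _ [->|[t [y [t0 Cy ->]]]] [->|[u [z [u0 Cz ->]]]];
  rewrite ?(add0r, addr0).
- by left.
- by right; exists u, z.
- by right; exists t, y.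
have tu0 : 0 < t + u by exact: addr_gt0.
have k0 : 0 <= t / (t + u) by rewrite divr_ge0// ltW.
have k1 : t / (t + u) <= 1 by rewrite ler_pdivrMr// mul1r lerDl ltW.
right; exists (t + u), ((t / (t + u)) *: y + (u / (t + u)) *: z); split=> //.
  have /set_mem := cC y z (Itv01 k0 k1) (mem_set Cy) (mem_set Cz).
  rewrite (_ : u / (t + u) = 1 - t / (t + u)) //.
  by field; rewrite gt_eqF.
rewrite scalerDr !scalerA; congr (_ *: _ + _ *: _); field; by rewrite gt_eqF.
Qed.

Section Chi.
Context {R : realType} {Omega : finType}.
Variable rho : (Omega -> R) -> bool -> R.
Hypothesis P1_closed : closed (P1 rho : set {ptws Omega -> R}).
Implicit Types (w : Omega) (mu : Omega -> R).

Lemma notP1_hat_lt0 mu : simplex mu -> ~ P1 rho mu -> rho_hat rho mu < 0.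
Proof.
by move=> smu nP; rewrite ltNge; apply/negP => h; apply: nP; split.
Qed.

(** As [w1] is in [K1], the weight 0 is admissible and [gamma] is the supremum of a nonempty bounded
    set; it is attained because [P1] is closed and [mix] is continuous in the weight. *)
Lemma gammaP w0 w1 : K1 rho w1 ->
  [/\ 0 <= gamma rho w0 w1 <= 1, P1 rho (chi rho w0 w1) &
    forall g, 0 <= g <= 1 -> P1 rho (mix g w0 w1) -> g <= gamma rho w0 w1].
Proof.
move=> K1w1; set E := [set g | 0 <= g <= 1 /\ P1 rho (mix g w0 w1)].
have E0 : E 0 by split; rewrite ?lexx ?ler01// mix0.
have ubE : ubound E 1 by move=> g [/andP[]].
have hE : has_ubound E by exists 1.
have En0 : E !=set0 by exists 0.
split.
- by rewrite ub_le_sup//= ge_sup.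
- have cl : closed [set g : R | P1 rho (mix g w0 w1)].
    exact: (continuous_closedP _).1 (continuous_mix w0 w1) _ P1_closed.
  apply: cl => B /(closure_sup En0 hE)[g [[_ P1g] Bg]].
  by exists g.
- by move=> g g01 P1g; apply: ub_le_sup.
Qed.

Lemma chixx w : chi rho w w = point_mass w.
Proof. exact: mixxx. Qed.

Lemma chi_K1 w0 w1 : K1 rho w0 -> K1 rho w1 -> chi rho w0 w1 = point_mass w0.
Proof.
move=> K1w0 /(gammaP w0 _)[/andP[_ g1] _ ub].
rewrite /chi (_ : gamma _ _ _ = 1) ?mix1//.
by apply/le_anti; rewrite g1 ub ?ler01 ?lexx// mix1.
Qed.

Lemma L0NK1 w : L0 rho w <-> ~ K1 rho w.
Proof.
split=> [[]//|nK1]; split=> //; split; first exact: simplex_point_mass.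
by apply/ltW/notP1_hat_lt0 => //; exact: simplex_point_mass.
Qed.

Hypothesis P1c_convex : convex_set (simplex `\` P1 rho).

Section Dual.
Variable l : Omega -> R.
Hypothesis l_chi : forall w0 w1, K1 rho w1 ->
  0 <= \sum_w chi rho w0 w1 w * l w.

Let l_ge0 w : K1 rho w -> 0 <= l w.
Proof. by move=> /(l_chi w _); rewrite chixx sum_point_mass. Qed.

(** If [w1] is in [K1], a weight [g] admissible for [P1] is at most [gamma]; as [l w0 < 0 <= l w1],
    the form at [chi] would be at most its value at [g], hence negative. Otherwise both ends of the
    edge lie in the convex complement of [P1]. *)
Lemma edge_notP1 g w0 w1 : l w0 < 0 -> 0 <= g <= 1 ->
  g * l w0 + (1 - g) * l w1 < 0 -> ~ P1 rho (mix g w0 w1).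
Proof.
move=> lw0 g01 lg.
have nK1w0 : ~ K1 rho w0 by move/l_ge0; rewrite leNgt lw0.
have [K1w1 P1g|nK1w1] := pselect (K1 rho w1).
  have [_ _ /(_ _ g01 P1g) gle] := gammaP w0 _ K1w1.
  have := l_chi w0 _ K1w1; rewrite sum_mix leNgt => /negP; apply.
  apply: le_lt_trans lg; rewrite -subr_ge0.
  rewrite (_ : _ - _ = (gamma rho w0 w1 - g) * (l w1 - l w0)); last by ring.
  rewrite mulr_ge0 ?subr_ge0// (le_trans (ltW lw0))// l_ge0//.
have C w : ~ K1 rho w ->
    (point_mass w : convex_lmodType (Omega -> R)) \in simplex `\` P1 rho.
  by move=> nK1; apply/mem_set; split => //; exact: simplex_point_mass.
have /andP[g0 g1] := g01.
by have /set_mem[_] := P1c_convex _ _ (Itv01 g0 g1) (C _ nK1w0) (C _ nK1w1).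
Qed.

(* After a shift m of l that makes a given belief mu a zero of m, mu is a
   nonnegative combination of zeros of m on the edges of the simplex. *)
Lemma P1_sum_ge0 mu : P1 rho mu -> 0 <= \sum_w mu w * l w.
Proof.
move=> P1mu; have [[mu0 mu1] _] := P1mu.
rewrite leNgt; apply/negP => d0; set d := \sum_w mu w * l w in d0.
pose m w := l w - d.
have mumu0 : \sum_w mu w * m w = 0.
  under eq_bigr do rewrite mulrBr.
  by rewrite sumrB -mulr_suml mu1 mul1r subrr.
(* The positive and negative parts of the zero sum [mumu0] balance: they are [a] and [- a]. *)
pose a := \sum_(w | 0 < m w) mu w * m w.
have aN : \sum_(w | m w < 0) mu w * m w = - a.
  apply/eqP; rewrite -addr_eq0 -[X in _ == X]mumu0.
  rewrite [X in _ == X](bigID (fun w => m w < 0))/=.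
  apply/eqP; congr (_ + _); rewrite /a [RHS](bigID (fun w => 0 < m w))/=.
  rewrite [X in _ = _ + X]big1 ?addr0; last first.
    move=> w; rewrite -!leNgt => /andP[? ?].
    by rewrite (_ : m w = 0) ?mulr0//; apply/le_anti/andP.
  by apply: eq_bigl => w; case: ltgtP.
have a_ge0 : 0 <= a by apply: sumr_ge0 => w mw; rewrite mulr_ge0// ltW.
(* This settles the degenerate case: for [a = 0] the division by [a] makes every [T] vanish, and
   [mu] is carried by the zeros of [m]. *)
have mu_m w : a = 0 -> mu w * m w = 0.
  move=> a0; apply/eqP/contraT => muw.
  have /orP[mw|mw] : (m w < 0) || (0 < m w).
  - by rewrite -neq_lt; apply: contraNneq muw => ->; rewrite mulr0.
  - have : mu w * - m w <= a.
      rewrite -[a]opprK -aN -sumrN (bigD1 w)//= -mulrN lerDl sumr_ge0// => i.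
      by move=> /andP[mi _]; rewrite -mulrN mulr_ge0// oppr_ge0 ltW.
    rewrite a0 mulrN oppr_le0 => h; case/negP: muw; apply/eqP/le_anti.
    by rewrite h andbT mulr_ge0_le0// ltW.
  - have : mu w * m w <= a.
      rewrite /a (bigD1 w)//= lerDl sumr_ge0// => i /andP[mi _].
      by rewrite mulr_ge0// ltW.
    rewrite a0 => h; case/negP: muw; apply/eqP/le_anti.
    by rewrite h mulr_ge0// ltW.
(* Each [T w0 w1] is a multiple of the zero of [m] on an edge. The factor [1 / a] makes the sum over
   [w1] of the first terms equal to [mu w0] times the point mass at [w0], and symmetrically for
   [w1]. *)
pose T w0 w1 : Omega -> R :=
  (mu w0 * mu w1 / a) *: (m w1 *: point_mass w0 - m w0 *: point_mass w1).
pose U w : Omega -> R := mu w *: point_mass w.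
have muE : mu = \sum_(w0 | m w0 < 0) \sum_(w1 | 0 < m w1) T w0 w1
                + \sum_(w | m w == 0) U w.
  apply/funext => w.
  have -> : mu w = \sum_w' mu w' * point_mass w' w.
    rewrite -(sum_point_mass w mu); apply: eq_bigr => i _.
    by rewrite mulrC /point_mass eq_sym.
  rewrite (bigID (fun w' => m w' == 0))/= addrC; congr (_ + _); last first.
    by rewrite fct_sumE.
  rewrite fct_sumE; under [RHS]eq_bigr do rewrite fct_sumE.
  have -> : \sum_(i | m i < 0) \sum_(j | 0 < m j) T i j w =
      (a / a) * \sum_(i | m i != 0) mu i * point_mass i w.
    rewrite [in RHS](bigID (fun i => m i < 0))/= mulrDr !mulr_sumr.
    transitivity (\sum_(i | m i < 0) \sum_(j | 0 < m j)
         ((mu i * point_mass i w / a) * (mu j * m j)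
          - (mu j * point_mass j w / a) * (mu i * m i))).
      apply: eq_bigr => i _; apply: eq_bigr => j _.
      have -> : T i j w = mu i * mu j / a *
        (m j * point_mass i w - m i * point_mass j w) by [].
      by ring.
    under eq_bigr do rewrite sumrB -mulr_sumr -/a.
    rewrite sumrB exchange_big/=; congr (_ + _).
      by apply: eq_big => [i|i _]; [case: ltgtP|ring].
    rewrite -sumrN; apply: eq_big => [i|i _]; first by case: ltgtP.
    by rewrite -mulr_sumr aN; ring.
  have [a0|a0] := eqVneq a 0; last by rewrite divff// mul1r.
  rewrite a0 mul0r mul0r big1// => i mi; have /eqP := mu_m i a0.
  by rewrite mulf_eq0 (negPf mi) orbF => /eqP ->; rewrite mul0r.
pose cone (x : Omega -> R) :=
  x = 0 \/ exists t y, [/\ 0 < t, (simplex `\` P1 rho) y & x = t *: y].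
have cone0 : cone 0 by left.
have coneD x y : cone x -> cone y -> cone (x + y) by exact: convex_cone_add.
have : cone mu.
  rewrite muE; apply/coneD.
  - apply: (big_ind _ cone0 coneD) => i mi; apply: (big_ind _ cone0 coneD) => j mj.
    have [k0|k0] := eqVneq (mu i * mu j / a) 0.
      by left; rewrite /T k0 scale0r.
    have mij : 0 < m j - m i by rewrite subr_gt0 (lt_trans mi).
    (* At this weight [m] vanishes, so [l] takes the value [d < 0] there; moreover [l i < d]. *)
    have g01 : 0 <= m j / (m j - m i) <= 1.
      rewrite divr_ge0 ?(ltW mj) ?(ltW mij)//= ler_pdivrMr// mul1r.
      by rewrite lerDl oppr_ge0 ltW.
    right; exists (mu i * mu j / a * (m j - m i)), (mix (m j / (m j - m i)) i j).
    split.
    + by rewrite mulr_gt0// lt_neqAle eq_sym k0/= divr_ge0// mulr_ge0.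
    + split; first exact: simplex_mix.
      apply: edge_notP1 => //; first by rewrite (lt_trans _ d0)// -subr_lt0.
      rewrite (_ : _ + _ = d)//.
      by rewrite /m; field; move: mij; rewrite /m => /gt_eqF ->.
    + rewrite /T /mix -[RHS]scalerA; congr (_ *: _).
      rewrite scalerDr !scalerA -scaleNr.
      by congr (_ *: _ + _ *: _); field; rewrite gt_eqF.
  (* At a state where [m] vanishes, [l] equals [d < 0], so the state is not in [K1]. *)
  - apply: (big_ind _ cone0 coneD) => i /eqP mi.
    have [k0|k0] := eqVneq (mu i) 0; first by left; rewrite /U k0 scale0r.
    right; exists (mu i), (point_mass i); split=> //.
      by rewrite lt_neqAle eq_sym k0 mu0.
    split; first exact: simplex_point_mass.
    move=> /l_ge0; rewrite leNgt => /negP; apply.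
    by move/eqP: mi; rewrite subr_eq0 => /eqP ->.
case=> [mu_eq0|[t [y [t0 [sy nP1y] muty]]]].
  by move: mu1; rewrite mu_eq0 big1// => /eqP; rewrite eq_sym oner_eq0.
(* Both [mu] and [y] have total mass 1. *)
suff t1 : t = 1 by apply: nP1y; move: P1mu; rewrite muty t1 scale1r.
rewrite -mu1 muty -[LHS]mulr1 -[in LHS]sy.2 mulr_sumr.
by apply: eq_bigr.
Qed.

End Dual.
End Chi.

(** * Schemes with arbitrary signal spaces *)

Lemma measurable_discrete (T : finType) (x0 : T) (A : set (discrete_space x0)) :
  measurable A.
Proof. by []. Qed.

Section GenericScheme.
Context {R : realType} {Omega : finType} {omega0 : Omega}.
Local Notation states := (discrete_space omega0).
Context {d} {S : measurableType d} (pi : probability (states * S)%type R).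

Definition action_mass (a : S -> bool) (b : bool) (w : Omega) : R :=
  fine (pi ([set (w : states)] `*` (a @^-1` [set b]))).

Lemma measurable_cylinder (w : states) (B : set S) :
  measurable B -> measurable ([set w] `*` B).
Proof. by move=> mB; apply: measurableX => //; exact: measurable_discrete. Qed.

Variables (a : S -> bool) (ma : measurable_fun setT a).

Lemma measurable_action b : measurable (a @^-1` [set b]).
Proof. by rewrite -[_ @^-1` _]setTI; exact: ma. Qed.

Lemma action_massE b (w : states) :
  pi ([set w] `*` (a @^-1` [set b])) = (action_mass a b w)%:E.
Proof.
rewrite fineK//; apply: fin_num_measure.
by apply: measurable_cylinder; exact: measurable_action.
Qed.

Lemma action_mass_ge0 b w : 0 <= action_mass a b w.
Proof. by rewrite fine_ge0. Qed.

Lemma action_massD (mu : Omega -> R) w : has_prior pi mu ->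
  action_mass a true w + action_mass a false w = mu w.
Proof.
move=> /(_ w) /= pimu; apply: EFin_inj; rewrite EFinD -!action_massE -pimu.
rewrite -measureU; [|by apply: measurable_cylinder; exact: measurable_action..|].
  congr (pi _); apply/seteqP; split => [[x s] /= [[-> _]|[-> _]]//|[x s] /= [-> _]].
  by case: (a s); [left|right].
by rewrite -subset0 => -[x s] /= [[_ /= asT] [_ /=]]; rewrite asT.
Qed.

(** The integrand is a finite combination of indicators of the cylinders [C (w, b)], on which state
    and action are constant. *)
Lemma sender_payoffE (v : Omega -> bool -> R) :
  sender_payoff v pi a =
  (\sum_w (action_mass a true w * v w true + action_mass a false w * v w false))%:E.
Proof.
pose C (x : Omega * bool) := [set (x.1 : states)] `*` (a @^-1` [set x.2]).
have mC x : measurable (C x) by by apply: measurable_cylinder; exact: measurable_action.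
rewrite /sender_payoff unlock.
transitivity (\int[pi]_x (\sum_(y : Omega * bool) (v y.1 y.2)%:E * (\1_(C y) x)%:E))%E.
  apply: eq_integral => -[w s] _ /=.
  rewrite (bigD1 ((w, a s) : Omega * bool))//= big1 ?adde0.
    by rewrite indicE mem_set ?mule1.
  move=> [w' b] /eqP ne; rewrite indicE memNset ?mule0//= => -[/= ww' asb].
  by apply: ne; rewrite ww' asb.
have iC y : pi.-integrable setT (fun x => (\1_(C y) x)%:E).
  exact: integrable_indic.
rewrite integral_sum//; last by move=> y; exact: integrableZl.
rewrite -(pair_bigA _ (fun w b => (\int[pi]_x ((v w b)%:E * (\1_(C (w, b)) x)%:E))%E))/=.
rewrite -sumEFin; apply: eq_bigr => w _; rewrite big_bool/=.
rewrite !integralZl// !integral_indic// !setIT /C/=.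
by rewrite !action_massE !EFinD !EFinM; congr (_ + _)%E; rewrite muleC.
Qed.

(** The masses sent to action [b] are the integrals of the posterior over the signals with
    [a s = b], so an inequality linear in the belief passes to them. *)
Lemma action_mass_sum_ge0 (m : S -> Omega -> R) (l : Omega -> R) b :
  is_posterior pi m ->
  (forall s, a s = b -> 0 <= \sum_w m s w * l w) ->
  0 <= \sum_w action_mass a b w * l w.
Proof.
move=> [sm mm pim] hl; set D := [set: states] `*` (a @^-1` [set b]).
have mD : measurable D by apply: measurableX => //; exact: measurable_action.
have im w : pi.-integrable D (fun x => (m x.2 w)%:E).
  apply: measurable_bounded_integrable => //.
  - by rewrite (le_lt_trans (probability_le1 _ _))// ltry.
  - apply: measurable_funTS.
    exact: (measurableT_comp (mm w) measurable_snd).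
  - exists 1; split=> // M M1 x _ /=; rewrite ger0_norm ?(sm _).1//.
    by rewrite (le_trans (simplex_le1 _ _ (sm _)))// ltW.
rewrite -lee_fin -sumEFin.
rewrite (_ : (\sum_w _)%E = \int[pi]_(x in D) \sum_w ((l w)%:E * (m x.2 w)%:E))%E.
  apply: integral_ge0 => -[x s] /= [_ asb].
  by under eq_bigr do rewrite -EFinM mulrC; rewrite sumEFin lee_fin hl.
rewrite integral_sum//; last by move=> y; exact: integrableZl.
apply: eq_bigr => w _; rewrite integralZl// -pim; last exact: measurable_action.
by rewrite action_massE EFinM muleC.
Qed.

End GenericScheme.

(** * Schemes with finitely many signals *)

Lemma finite_probability (R : realType) d (X : measurableType d) (I : finType)
    (f : I -> X) (p : I -> R) :
  (forall i, 0 <= p i) -> \sum_i p i = 1 ->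
  exists P : probability X R,
    (forall A, P A = \sum_i (p i)%:E * \d_(f i) A)%E /\
    forall (D : set X) (g : X -> \bar R), measurable D -> measurable_fun D g ->
      (forall x, D x -> 0 <= g x)%E ->
      (\int[P]_(x in D) g x = \sum_i (p i)%:E * (\d_(f i) D * g (f i)))%E.
Proof.
move=> p0 p1.
pose F i : {measure set X -> \bar R} := mscale (NngNum (p0 i)) \d_(f i).
(* [msum] adds a sequence of measures, so [I] is enumerated and the sequence padded with the zero
   measure. *)
pose m_ (k : nat) : {measure set X -> \bar R} :=
  if insub k is Some j then F (enum_val (j : 'I_#|I|)) else mzero.
pose P := msum m_ #|I|.
have sumE (G : {measure set X -> \bar R} -> \bar R) :
    (\sum_(k < #|I|) G (m_ k) = \sum_i G (F i))%E.
  transitivity (\sum_(i in I) G (F i))%E; last exact: eq_bigl.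
  by rewrite [RHS]big_enum_val; apply: eq_bigr => k _; rewrite /m_ valK.
have PE A : P A = (\sum_i (p i)%:E * \d_(f i) A)%E.
  exact: (sumE (fun m => m A)).
have PT : P setT = 1%E.
  rewrite PE; under eq_bigr do rewrite diracT mule1.
  by rewrite sumEFin p1.
pose P' : probability X R := HB.pack_for (probability X R) P
  (Measure_isProbability.Build d X R P PT).
exists P'; split=> [//|D g mD mg g0].
rewrite [LHS](ge0_integral_measure_sum m_ mD g0 mg).
rewrite (sumE (fun m => \int[m]_(x in D) g x)%E).
apply: eq_bigr => i _.
by rewrite (ge0_integral_mscale _ mD)// integral_dirac.
Qed.

(* [discrete_topology] would not do: it has no pointed uniform structure over an
   arbitrary pointed type. *)
Definition polish_space {T : finType} (x0 : T) : Type := discrete_space x0.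

Section PolishSpace.
Context (T : finType) (x0 : T).
Local Notation X := (polish_space x0).

HB.instance Definition _ := Pointed.copy X (discrete_space x0).
HB.instance Definition _ := hasNbhs.Build X principal_filter.
HB.instance Definition _ := Discrete_ofNbhs.Build X erefl.
HB.instance Definition _ := DiscreteUniform_ofNbhs.Build X.

(** The diagonal is an entourage, so a Cauchy filter contains a set with at most one point and
    converges to that point. *)
Lemma polish_space_complete (F : set_system X) :
  ProperFilter F -> cauchy F -> cvg F.
Proof.
move=> FF /(_ [set x | x.1 = x.2]) [|[A B] /= [FA FB] AB].
  by rewrite uniform_discrete => _ [x _ <-].
have [x Bx] := filter_ex FB.
apply/cvg_ex; exists x; apply/discrete_cvg.
by apply: filterS FA => y Ay; exact: (AB (y, x)).
Qed.

HB.instance Definition _ := Uniform_isComplete.Build X polish_space_complete.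
HB.instance Definition _ (R : numDomainType) :=
  @DiscretePseudoMetric_ofUniform.Build R X.

End PolishSpace.

Lemma standard_borel_discrete_space (R : realType) (T : finType) (x0 : T) :
  standard_borel R (discrete_space x0).
Proof.
exists (polish_space x0 : completePseudoMetricType R), id; split.
- exact: discrete_hausdorff.
- exists setT; last by move=> U U0 oU; rewrite setIT.
  exact/finite_set_countable/(@finite_finset T).
- by exists id.
- move=> A; split=> // _; exists A => //; apply: sub_sigma_algebra.
  exact: discrete_open.
Qed.

(** The joint law gives mass [c s * m s w] to [(w, s)]. Signals of weight zero also carry a belief,
    which the null-set freedom in posteriors permits. *)
Lemma finite_scheme (R : realType) (Omega T : finType) (omega0 : Omega) (t0 : T)
    (m : T -> Omega -> R) (c : T -> R) (mu : Omega -> R) :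
  simplex mu -> (forall s, simplex (m s)) -> (forall s, 0 <= c s) ->
  (forall w, mu w = \sum_s c s * m s w) ->
  exists pi : probability (discrete_space omega0 * discrete_space t0)%type R,
    is_scheme pi mu m /\
    forall v a, sender_payoff v pi a =
      (\sum_s c s * \sum_w m s w * v w (a s))%:E.
Proof.
move=> smu sm c0 mucm.
have p0 (x : Omega * T) : 0 <= c x.2 * m x.2 x.1.
  by rewrite mulr_ge0// (sm _).1.
have p1 : \sum_(x : Omega * T) c x.2 * m x.2 x.1 = 1.
  rewrite -(pair_bigA _ (fun w s => c s * m s w))/= -smu.2.
  by apply: eq_bigr => w _; rewrite mucm.
have [pi [piE int_piE]] := @finite_probability R _
  (discrete_space omega0 * discrete_space t0)%type (Omega * T)%type id _ p0 p1.
have pi_cyl (w : Omega) (B : set T) :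
    pi ([set w] `*` B) = (\sum_s c s * m s w * (s \in B)%:R)%:E.
  rewrite piE; under eq_bigr do rewrite diracE -EFinM.
  rewrite sumEFin -(pair_bigA _ (fun w' s => c s * m s w' *
    (((w', s) : discrete_space omega0 * discrete_space t0) \in [set w] `*` B)%:R))/=.
  rewrite (bigD1 w)//= [X in _ + X]big1 ?addr0; last first.
    move=> w' /eqP ww'; apply: big1 => s _.
    by rewrite memNset ?mulr0// => -[/= /ww'].
  congr EFin; apply: eq_bigr => s _; congr (_ * _%:R).
  congr nat_of_bool.
  by apply/idP/idP => [/set_mem[_ /mem_set]|/set_mem sB]//; apply/mem_set.
have mfun (f : discrete_space t0 -> R) : measurable_fun setT f by [].
exists pi; split; first split.
- exact: standard_borel_discrete_space.
- move=> w; rewrite pi_cyl mucm; congr EFin; apply: eq_bigr => s _.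
  by rewrite mem_set// mulr1.
- split=> // w B mB.
  rewrite pi_cyl int_piE; first last.
  + by move=> x _; rewrite lee_fin (sm _).1.
  + apply: measurable_funTS; apply/measurable_EFinP.
    exact: (measurableT_comp (mfun (fun s => m s w)) measurable_snd).
  + exact: measurableX.
  under [RHS]eq_bigr do rewrite diracE -!EFinM.
  rewrite sumEFin -(pair_bigA _ (fun w' s => c s * m s w' *
    ((((w', s) : discrete_space omega0 * discrete_space t0)
        \in setT `*` B)%:R * m s w)))/=.
  rewrite exchange_big/=; congr EFin; apply: eq_bigr => s _.
  pose k : R := (s \in B)%:R.
  (* The state [w'] drawn jointly with [s] integrates out, as [m s] has total mass 1. *)
  transitivity (c s * m s w * k * \sum_w' m s w'); first by rewrite (sm s).2 mulr1.
  rewrite mulr_sumr; apply: eq_bigr => w' _.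
  rewrite (_ : _%:R = k); first by ring.
  congr (nat_of_bool _)%:R.
  by apply/idP/idP => [/set_mem[_ /mem_set]|/set_mem sB]//; apply/mem_set.
- move=> v a.
  have ma : measurable_fun setT (a : discrete_space t0 -> bool) by [].
  rewrite (sender_payoffE _ _ ma); congr EFin.
  under [RHS]eq_bigr do rewrite mulr_sumr.
  rewrite exchange_big/=; apply: eq_bigr => w _.
  have amE b : action_mass pi a b w = \sum_s c s * m s w * (a s == b)%:R.
    rewrite /action_mass pi_cyl/=; apply: eq_bigr => s _; congr (_ * _%:R).
    by congr nat_of_bool; apply/idP/eqP; rewrite !inE.
  rewrite !amE !mulr_suml -big_split/=; apply: eq_bigr => s _.
  by case: (a s); rewrite /= ?(eqxx, mulr1, mulr0, mul0r, addr0, add0r) mulrA.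
Qed.

(** * Canonical signals and comparison with arbitrary schemes *)

(** Weights on the diagonal describe full revelation, the signal [(w, w)] revealing [w]. *)
Lemma sum_diag (R : pzSemiRingType) (I : finType) (f : I -> R) (g : I * I -> R) :
  \sum_(x : I * I) (if x.1 == x.2 then f x.1 else 0) * g x =
  \sum_i f i * g (i, i).
Proof.
transitivity (\sum_i \sum_j (if i == j then f i else 0) * g (i, j)).
  by rewrite pair_bigA; apply: eq_bigr => -[].
apply: eq_bigr => i _; rewrite (bigD1 i)//= eqxx big1 ?addr0// => j.
by rewrite eq_sym => /negPf ->; rewrite mul0r.
Qed.

Section CanonicalBelief.
Context {R : realType} {Omega : finType}.
Variable rho : (Omega -> R) -> bool -> R.
Hypothesis P1_closed : closed (P1 rho : set {ptws Omega -> R}).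
Hypothesis P1c_convex : convex_set (simplex `\` P1 rho).

(** All pairs of states serve as signals, which gives the linear program a finite index type. A pair
    with second state in [K1] recommends action 1; any other pair reveals its second state and
    recommends action 0. *)
Definition canonical_action (s : Omega * Omega) : bool := `[< K1 rho s.2 >].

(* chi w0 w1 is the point mass at w0 as soon as w0 is in K1, and chi w w is
   always the point mass at w. *)
Definition canonical_belief (s : Omega * Omega) : Omega -> R :=
  if canonical_action s then chi rho s.1 s.2 else point_mass s.2.

Local Notation act := canonical_action.
Local Notation bel := canonical_belief.

Lemma canonical_beliefxx w : bel (w, w) = point_mass w.
Proof. by rewrite /bel chixx if_same. Qed.

Lemma canonical_belief_simplex s : simplex (bel s).
Proof.
rewrite /bel /act; case: asboolP => [K1s|_]; last exact: simplex_point_mass.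
by have [_ []] := gammaP _ P1_closed s.1 _ K1s.
Qed.

Lemma canonical_belief_range s : (range point_mass `|` K01 rho) (bel s).
Proof.
rewrite /bel /act; case: asboolP => [K1s|_]; last by left; exists s.2.
have [K1s1|/L0NK1 L0s] := pselect (K1 rho s.1).
  by left; exists s.1; rewrite // chi_K1.
by right; exists s.1, s.2.
Qed.

Lemma canonical_action_optimal s b : rho (bel s) b <= rho (bel s) (act s).
Proof.
rewrite /bel /act; case: asboolP => [K1s|nK1s].
  have [_ [_ h] _] := gammaP _ P1_closed s.1 _ K1s.
  by case: b => //; rewrite -subr_ge0.
case: b => //; rewrite -subr_le0; apply/ltW/notP1_hat_lt0 => //.
exact: simplex_point_mass.
Qed.

Lemma scheme_le_canonical (omega0 : Omega) (v : Omega -> bool -> R)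
    (v_mono : forall w, v w false <= v w true) (mu : Omega -> R)
    d (S : measurableType d)
    (pi : probability (discrete_space omega0 * S)%type R)
    (m : S -> Omega -> R) (a : S -> bool) :
  is_scheme pi mu m -> receiver_optimal rho m a ->
  exists c : Omega * Omega -> R,
    [/\ forall s, 0 <= c s, forall w, mu w = \sum_s c s * bel s w &
      (sender_payoff v pi a <=
        (\sum_s c s * \sum_w bel s w * v w (act s))%:E)%E].
Proof.
move=> [_ prior post] [ma opt].
pose q b w := action_mass pi a b w.
(* Signals recommending action 0 enter as zero generators, and [c'] below drops their coefficients.
   A form nonnegative on the others is nonnegative on [P1], hence on every posterior that leads to
   action 1. *)
have [x gx|c c0 qc] := @farkas R (Omega * Omega)%type Omega
    (fun s w => if act s then bel s w else 0) (q true).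
  apply: (action_mass_sum_ge0 _ _ ma _ _ _ post) => s as1.
  apply: (P1_sum_ge0 _ P1_closed P1c_convex) => [w0 w1 K1w1|].
    have actT : act (w0, w1) by exact/asboolP.
    by have := gx (w0, w1); rewrite actT /bel actT.
  split; first by case: post.
  by rewrite /= subr_ge0 -as1.
(* The mass that the given scheme sends to action 0 is revealed on the diagonal. *)
pose c' (s : Omega * Omega) :=
  (if act s then c s else 0) + (if s.1 == s.2 then q false s.1 else 0).
have qcE (f : Omega -> R) :
    \sum_s (if act s then c s else 0) * \sum_w bel s w * f w =
    \sum_w q true w * f w.
  under [RHS]eq_bigr do rewrite qc mulr_suml.
  rewrite exchange_big/=; apply: eq_bigr => s _; rewrite mulr_sumr.
  by apply: eq_bigr => w _; case: ifP => _; rewrite ?mulrA// !(mul0r, mulr0).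
exists c'; split.
- move=> s; rewrite addr_ge0//; case: ifP => // _.
  exact: action_mass_ge0.
- move=> w; rewrite -(action_massD _ _ ma _ w prior).
  under [RHS]eq_bigr do rewrite mulrDl.
  rewrite big_split/= sum_diag; congr (_ + _).
    rewrite -/(q true w) qc; apply: eq_bigr => s _.
    by case: ifP; rewrite ?mul0r ?mulr0.
  under eq_bigr do rewrite canonical_beliefxx.
  rewrite -/(q false w) -(sum_point_mass w (q false)).
  by apply: eq_bigr => i _; rewrite mulrC /point_mass eq_sym.
- rewrite sender_payoffE// lee_fin.
  under [leRHS]eq_bigr do rewrite mulrDl.
  rewrite !big_split/= sum_diag; apply: lerD.
    rewrite -qcE; apply: ler_sum => s _.
    by case: ifP => _; rewrite ?mul0r.
  (* Revelation changes the action only from 0 to 1, at states of [K1], and [v_mono] makes this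
     harmless. *)
  apply: ler_sum => w _; rewrite canonical_beliefxx sum_point_mass.
  apply: ler_wpM2l; first exact: action_mass_ge0.
  by case: act.
Qed.

End CanonicalBelief.

Theorem mainTheorem5 (R : realType) (Omega : finType) (omega0 : Omega)
    (rho : (Omega -> R) -> bool -> R) (v : Omega -> bool -> R)
    (v_mono : forall w, v w false <= v w true)
    (P0_closed : closed (P0 rho : set {ptws Omega -> R}))
    (P1_closed : closed (P1 rho : set {ptws Omega -> R}))
    (P1c_convex : convex_set (simplex `\` P1 rho)) :
  canonical_signals omega0 rho v (range point_mass `|` K01 rho).
Proof.
move=> mu smu.
pose bel := canonical_belief rho; pose act := canonical_action rho.
(* Full revelation is a feasible point, and the payoff of playing action 1 in every state bounds the
   program. *)
have [|c [c0 muc]|c [c0 muc] cmax] := @lp_max R _ _ bel mu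
    (fun s => \sum_w bel s w * v w (act s)) (\sum_w mu w * v w true)
    (fun s => if s.1 == s.2 then mu s.1 else 0).
- split=> [s|w]; first by case: ifP => // _; exact: smu.1.
  rewrite sum_diag -(sum_point_mass w mu); apply: eq_bigr => i _.
  by rewrite /bel canonical_beliefxx mulrC /point_mass eq_sym.
- under [leRHS]eq_bigr do rewrite muc mulr_suml.
  rewrite exchange_big/=; apply: ler_sum => s _; rewrite mulr_sumr.
  apply: ler_sum => w _; rewrite -mulrA.
  apply: ler_wpM2l => //; apply: ler_wpM2l.
    by have [] := canonical_belief_simplex _ P1_closed s.
  by case: act.
have [pi [scheme payoff]] := @finite_scheme R Omega _ omega0 (omega0, omega0)
  bel c mu smu (canonical_belief_simplex _ P1_closed) c0 muc.
exists _, (discrete_space (omega0, omega0)), pi, bel; split; last first.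
  exact: canonical_belief_range.
split=> //; exists act.
  split; first by [].
  exact: canonical_action_optimal.
move=> d' S' pi' m' a' scheme' opt'.
have [c' [c'0 muc' le]] :=
  scheme_le_canonical _ P1_closed P1c_convex _ _ v_mono _ _ _ _ _ _ scheme' opt'.
apply: (le_trans le); rewrite payoff lee_fin.
exact: cmax.
Qed.
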